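(* There is an open neighborhood of the first bisector $\{(x,x):x>0\}$ in $(0,+\infty)^2$ on which, writing $A=\frac{x+y}{2}$, the following expansions hold: $$H(x,y)=A-\frac{1}{4A}(x-y)^2,$$ $$G(x,y)=A-\sum_{n=1}^{+\infty}\frac{\binom{2n}{n}}{16^n(2n-1)A^{2n-1}}(x-y)^{2n},$$ $$E(x,y)=A+\sum_{n=1}^{+\infty}\frac{B_{2n}}{(2n)\cdot(2n)!}(x-y)^{2n}.$$
   Context: For $x,y>0$: $H(x,y)=\frac{2xy}{x+y}$ (harmonic mean), $G(x,y)=\sqrt{xy}$ (geometric mean), and $E$ is the exponential mean, $E(x,y)=\log\left(\frac{e^x-e^y}{x-y}\right)$ if $x\ne y$, $E(x,x)=x$. The Bernoulli numbers $B_k$ are defined by $\frac{t}{e^t-1}=\sum_{k=0}^{+\infty}B_k\frac{t^k}{k!}$. *)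

(* Defs.v *)
(* Stdlib reals, with Coquelicot for topology and series. *)
From Stdlib Require Import Reals Factorial ClassicalEpsilon.
From Coquelicot Require Import Coquelicot.
Open Scope R_scope.

Definition harmonic_mean (x y : R) : R := 2 * x * y / (x + y).

Definition geometric_mean (x y : R) : R := sqrt (x * y).

Definition exponential_mean (x y : R) : R :=
  if Req_EM_T x y then x else ln ((exp x - exp y) / (x - y)).

(* [B] is the exponential generating sequence of [t / (exp t - 1)] near 0.  The
   identity is only required at [t <> 0], because Rocq's totalised quotient does
   not take the limit value 1 at [t = 0]. *)
Definition is_bernoulli (B : nat -> R) : Prop :=
  locally' 0 (fun t : R =>
    is_pseries (fun k => B k / INR (fact k)) t (t / (exp t - 1))).

(* At most one sequence satisfies [is_bernoulli], so the choice is harmless. *)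
Definition bernoulli : nat -> R :=
  epsilon (inhabits (fun _ : nat => 0)) is_bernoulli.

(* Main.v *)
Require Import Defs.
From Stdlib Require Import Reals Factorial Lra Lia ClassicalEpsilon.
From Coquelicot Require Import Coquelicot.
Open Scope R_scope.

(** Write [A = (x + y) / 2] and [t = x - y].  The harmonic mean
    is [x y / A], and [x y = A ^ 2 - t ^ 2 / 4].

    For the geometric mean, the same identity gives
    [sqrt (x y) = A * sqrt (1 - u)] with [u = t ^ 2 / (4 A ^ 2)], and
    [0 <= u < 1] for all positive [x, y].  The binomial series of
    [sqrt (1 - u)] has coefficients satisfying
    [(n + 1) s_{n+1} = (n - 1/2) s_n], so its sum [S] solves
    [(1 - u) S' = - S / 2] on the unit disk, and hence [S / sqrt (1 - u)] is
    constant ([PSeries_sqrt_coef]).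

    For the exponential mean, let [P t = t / (exp t - 1)].  Factoring
    [exp y] out of [exp x - exp y] gives [E (x, y) = A + M t] with
    [M t = - ln (P t) - t / 2].  This [M] is the even function
    [ln (sinh (t / 2) / (t / 2))].  Differentiating [(exp t - 1) * P t = t]
    yields [M' t = (P t - 1) / t + 1 / 2], whose power series can be read off
    from that of [P]; termwise integration gives
    [M t = t / 2 + sum_{k >= 1} B_k / (k * k!) * t ^ k]
    ([log_potential_expansion]).  Averaging over [t] and [- t] leaves only the
    even terms.

    All this presupposes that the Bernoulli numbers exist, that is, that
    [t / (exp t - 1)] is the sum of a power series near [0].  This series is
    constructed as the formal inverse of [sum t ^ n / (n + 1)!]
    ([recip_coef]); its coefficients are bounded by [1] because
    [1/2! + 1/3! + ... <= 1], so it converges on the unit disk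
    ([bernoulli_spec]).

    The neighbourhood is [{x > 0, y > 0, |x - y| < r}], where [r] is a radius
    on which the Bernoulli expansion is valid. *)

(** * Radii of convergence *)

Lemma CV_radius_ge_of_bounded (a : nat -> R) (r M : R) :
  (forall n, Rabs (a n * r ^ n) <= M) -> Rbar_le r (CV_radius a).
Proof.
  intros Hb; apply (proj1 (CV_radius_bounded a)); now exists M.
Qed.

Lemma lt_CV_radius_of_coef_le_1 (a : nat -> R) (x : R) :
  (forall n, Rabs (a n) <= 1) -> Rabs x < 1 -> Rbar_lt (Rabs x) (CV_radius a).
Proof.
  intros Hb Hx.
  apply Rbar_lt_le_trans with 1; [exact Hx|].
  apply CV_radius_ge_of_bounded with 1; intros n.
  now rewrite pow1, Rmult_1_r.
Qed.

Lemma Rabs_le_CV_radius (a : nat -> R) (x : R) :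
  ex_pseries a x -> Rbar_le (Rabs x) (CV_radius a).
Proof.
  intros [l Hl]; apply Rbar_not_lt_le; intros Hlt.
  apply (CV_disk_outside a x Hlt).
  apply ex_series_lim_0; exists l; now apply is_pseries_R.
Qed.

(** Convergence on an interval is upgraded to a strict bound on the radius by
    going to the midpoint of [Rabs x] and [r]. *)
Lemma Rabs_lt_CV_radius (a : nat -> R) (r x : R) :
  (forall t, 0 < t < r -> ex_pseries a t) -> Rabs x < r ->
  Rbar_lt (Rabs x) (CV_radius a).
Proof.
  intros Ha Hx; pose proof (Rabs_pos x) as Hx0.
  apply Rbar_lt_le_trans with ((Rabs x + r) / 2); [simpl; lra|].
  rewrite <- (Rabs_pos_eq ((Rabs x + r) / 2)) by lra.
  apply Rabs_le_CV_radius, Ha; lra.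
Qed.

(** * The binomial series of the square root *)

(** The [n]-th Taylor coefficient [(-1) ^ n * binom (1/2) n] of
    [sqrt (1 - u)].  The real number [2 * INR n - 1] is [-1] at [n = 0], which
    makes the constant coefficient [1]. *)
Definition sqrt_coef (n : nat) : R :=
  - (Binomial.C (2 * n) n / (4 ^ n * (2 * INR n - 1))).

Lemma two_INR_sub_1_neq_0 (n : nat) : 2 * INR n - 1 <> 0.
Proof.
  destruct n as [|n]; [simpl; lra|].
  rewrite S_INR; pose proof (pos_INR n); lra.
Qed.

Lemma sqrt_coef_0 : sqrt_coef 0 = 1.
Proof. unfold sqrt_coef, Binomial.C; simpl; field. Qed.

(** The ratio of consecutive coefficients: it bounds them by [1] and is the
    differential equation of the series read coefficientwise. *)
Lemma sqrt_coef_S (n : nat) :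
  INR (S n) * sqrt_coef (S n) = (INR n - / 2) * sqrt_coef n.
Proof.
  unfold sqrt_coef, Binomial.C.
  replace (2 * S n - S n)%nat with (S n) by lia.
  replace (2 * n - n)%nat with n by lia.
  replace (2 * S n)%nat with (S (S (2 * n))) by lia.
  rewrite !fact_simpl, !mult_INR, !S_INR, mult_INR; simpl (4 ^ S n).
  change (INR 2) with 2.
  pose proof (pos_INR n).
  pose proof (INR_fact_neq_0 n). pose proof (two_INR_sub_1_neq_0 n).
  pose proof (pow_nonzero 4 n ltac:(lra)).
  field; repeat split; try assumption; lra.
Qed.

Lemma sqrt_coef_bound (n : nat) : Rabs (sqrt_coef n) <= 1.
Proof.
  induction n as [|n IH]; [rewrite sqrt_coef_0, Rabs_R1; lra|].
  assert (Hn : 0 <= INR n) by apply pos_INR.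
  assert (HS : 0 < INR (S n)) by (rewrite S_INR; lra).
  assert (E : sqrt_coef (S n) = (INR n - / 2) / INR (S n) * sqrt_coef n).
  { apply Rmult_eq_reg_l with (INR (S n)); [|lra].
    rewrite sqrt_coef_S; field; lra. }
  rewrite E, Rabs_mult.
  assert (Rabs ((INR n - / 2) / INR (S n)) <= 1).
  { rewrite Rabs_div, (Rabs_pos_eq (INR (S n))) by lra.
    apply Rle_div_l; [lra|].
    rewrite S_INR; apply Rabs_le; lra. }
  pose proof (Rabs_pos (sqrt_coef n)).
  pose proof (Rabs_pos ((INR n - / 2) / INR (S n))). nra.
Qed.

Lemma PSeries_sqrt_coef_ode (u : R) :
  Rabs u < 1 ->
  (1 - u) * PSeries (PS_derive sqrt_coef) u = - / 2 * PSeries sqrt_coef u.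
Proof.
  intros Hu.
  pose proof (lt_CV_radius_of_coef_le_1 _ _ sqrt_coef_bound Hu) as Hr.
  assert (Hd : ex_pseries (PS_derive sqrt_coef) u) by now apply ex_pseries_derive.
  assert (E : PSeries (PS_derive sqrt_coef) u =
    PSeries (PS_minus (PS_incr_1 (PS_derive sqrt_coef))
                      (PS_scal (/ 2) sqrt_coef)) u).
  { apply PSeries_ext; intros n; unfold PS_derive at 1.
    rewrite sqrt_coef_S.
    unfold PS_minus, PS_plus, PS_opp, PS_scal, PS_incr_1, PS_derive.
    unfold plus, opp, scal; simpl; unfold mult; simpl.
    destruct n as [|n]; [change (@zero _) with 0; simpl; ring|rewrite S_INR; destruct n; simpl; ring]. }
  rewrite PSeries_minus, PSeries_incr_1, PSeries_scal in E.
  - lra.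
  - now apply ex_pseries_incr_1.
  - apply ex_pseries_scal; [apply Rmult_comm|].
    now apply CV_radius_inside.
Qed.

(** The quotient [S / sqrt (1 - u)] has zero derivative by the differential
    equation, and its value at [0] is [1]. *)
Lemma PSeries_sqrt_coef (u : R) :
  0 <= u < 1 -> PSeries sqrt_coef u = sqrt (1 - u).
Proof.
  intros Hu.
  destruct (Req_dec u 0) as [->|Hu0].
  { rewrite PSeries_0, sqrt_coef_0, Rminus_0_r, sqrt_1; reflexivity. }
  assert (E : PSeries sqrt_coef 0 / sqrt (1 - 0) =
              PSeries sqrt_coef u / sqrt (1 - u)).
  { apply (eq_is_derive (fun t => PSeries sqrt_coef t / sqrt (1 - t)));
      [|lra].
    intros t Ht.
    assert (Ht1 : Rabs t < 1) by (rewrite Rabs_pos_eq; lra).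
    assert (Hs : 0 < sqrt (1 - t)) by (apply sqrt_lt_R0; lra).
    assert (Hss : sqrt (1 - t) * sqrt (1 - t) = 1 - t) by (apply sqrt_sqrt; lra).
    pose proof (PSeries_sqrt_coef_ode t Ht1) as Hode.
    pose proof (is_derive_PSeries sqrt_coef t
      (lt_CV_radius_of_coef_le_1 _ _ sqrt_coef_bound Ht1)) as HP.
    assert (HQ : is_derive (fun t => sqrt (1 - t)) t (- / (2 * sqrt (1 - t)))).
    { auto_derive; [lra|fold (1-t); field; lra]. }
    evar_last; [apply is_derive_div; [exact HP|exact HQ|lra]|].
    unfold zero; simpl.
    set (P := PSeries sqrt_coef t) in *.
    set (P' := PSeries (PS_derive sqrt_coef) t) in *.
    set (s := sqrt (1 - t)) in *.
    rewrite <- Hss in Hode.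
    replace (_ / _) with ((s * s * P' + / 2 * P) / (s * s * s)) by (field; lra).
    rewrite Hode; field; lra. }
  rewrite PSeries_0, sqrt_coef_0, Rminus_0_r, sqrt_1 in E.
  assert (Hs : 0 < sqrt (1 - u)) by (apply sqrt_lt_R0; lra).
  apply Rmult_eq_reg_r with (/ sqrt (1 - u)).
  - unfold Rdiv in E; rewrite <- E; field; lra.
  - apply Rinv_neq_0_compat; lra.
Qed.

(** This is [A * (1 - sqrt (1 - u))] with [u = (x - y) ^ 2 / (4 * A ^ 2)],
    expanded without the constant term of the square root. *)
Lemma geometric_mean_expansion (x y : R) :
  0 < x -> 0 < y ->
  is_series (fun k => Binomial.C (2 * S k) (S k) /
      (16 ^ S k * INR (2 * S k - 1) * ((x + y) / 2) ^ (2 * S k - 1))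
      * (x - y) ^ (2 * S k))
    ((x + y) / 2 - sqrt (x * y)).
Proof.
  intros Hx Hy.
  set (A := (x + y) / 2).
  assert (HA : 0 < A) by (unfold A; lra).
  set (u := (x - y) ^ 2 / (4 * A ^ 2)).
  assert (HA2 : 0 < 4 * A ^ 2) by nra.
  assert (Hu : 0 <= u < 1).
  { split.
    - apply Rdiv_le_0_compat; [apply pow2_ge_0|exact HA2].
    - apply Rlt_div_l; [exact HA2|]; unfold A; nra. }
  assert (HG : sqrt (x * y) = A * sqrt (1 - u)).
  { rewrite <- (sqrt_pow2 A) at 1 by lra.
    rewrite <- sqrt_mult by nra; f_equal.
    unfold u, A; field; lra. }
  assert (Hs : is_series (fun n => sqrt_coef n * u ^ n) (sqrt (1 - u))).
  { apply is_pseries_R; rewrite <- PSeries_sqrt_coef by exact Hu.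
    apply PSeries_correct, CV_radius_inside, lt_CV_radius_of_coef_le_1.
    - apply sqrt_coef_bound.
    - rewrite Rabs_pos_eq; lra. }
  apply (is_series_scal_l (- A)) in Hs.
  apply is_series_ext with
    (fun k => (fun n => scal (- A) (sqrt_coef n * u ^ n)) (S k)).
  - intros k.
    change (- A * (sqrt_coef (S k) * u ^ S k) =
      Binomial.C (2 * S k) (S k) /
      (16 ^ S k * INR (2 * S k - 1) * A ^ (2 * S k - 1)) * (x - y) ^ (2 * S k)).
    unfold sqrt_coef.
    assert (Hp : (2 * S k - 1 = 1 + 2 * k)%nat) by lia.
    rewrite Hp. replace (INR (1 + 2 * k)) with (2 * INR (S k) - 1)
      by (rewrite plus_INR, mult_INR, S_INR; simpl; ring).
    replace (16 ^ S k) with (4 ^ S k * 4 ^ S k)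
      by (rewrite <- Rpow_mult_distr; f_equal; ring).
    unfold u, Rdiv; rewrite Rpow_mult_distr, pow_inv, Rpow_mult_distr, <- !pow_mult.
    replace (A ^ (2 * S k)) with (A * A ^ (1 + 2 * k))
      by (rewrite tech_pow_Rmult; f_equal; lia).
    field; repeat split; try apply pow_nonzero; try lra.
    apply two_INR_sub_1_neq_0.
  - apply (is_series_incr_1 (fun n => scal (- A) (sqrt_coef n * u ^ n))).
    evar_last; [exact Hs|].
    unfold scal, plus; simpl; unfold mult; simpl.
    rewrite sqrt_coef_0, HG; ring.
Qed.

(** * Reciprocal of a power series *)

(** The reciprocal coefficients satisfy a recursion that uses all earlier ones.
    To make it structural, [recip_prefix a n] is a whole sequence, correct up to
    index [n], and the step to [S n] changes only the entries beyond [n]. *)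
Fixpoint recip_prefix (a : nat -> R) (n k : nat) : R :=
  match n with
  | O => 1
  | S m =>
      if (k <=? m)%nat then recip_prefix a m k
      else - sum_f_R0 (fun j => a (S j) * recip_prefix a m (m - j)%nat) m
  end.

Definition recip_coef (a : nat -> R) (n : nat) : R := recip_prefix a n n.

Lemma recip_prefix_stable (a : nat -> R) (n k : nat) :
  (k <= n)%nat -> recip_prefix a n k = recip_coef a k.
Proof.
  induction n as [|n IH]; intros Hk.
  - now replace k with 0%nat by lia.
  - destruct (Nat.eq_dec k (S n)) as [->|Hne]; [reflexivity|].
    simpl; rewrite (proj2 (Nat.leb_le k n)) by lia; apply IH; lia.
Qed.

Lemma recip_coef_S (a : nat -> R) (n : nat) :
  recip_coef a (S n) =
  - sum_f_R0 (fun j => a (S j) * recip_coef a (n - j)%nat) n.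
Proof.
  unfold recip_coef at 1; cbn [recip_prefix]; rewrite (proj2 (Nat.leb_gt (S n) n)) by lia.
  f_equal; apply sum_eq; intros j Hj.
  rewrite recip_prefix_stable by lia; reflexivity.
Qed.

(** Each coefficient is a combination of earlier ones with weights of total
    absolute value at most [1], so the bound [1] propagates. *)
Lemma recip_coef_bound (a : nat -> R) (n : nat) :
  (forall m, sum_f_R0 (fun j => Rabs (a (S j))) m <= 1) ->
  Rabs (recip_coef a n) <= 1.
Proof.
  intros Ha; induction n as [n IH] using Wf_nat.lt_wf_ind.
  destruct n as [|n].
  - unfold recip_coef; simpl; rewrite Rabs_R1; lra.
  - rewrite recip_coef_S, Rabs_Ropp.
    eapply Rle_trans; [apply Rsum_abs|].
    eapply Rle_trans; [|apply (Ha n)].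
    apply sum_Rle; intros j Hj; rewrite Rabs_mult.
    pose proof (IH (n - j)%nat ltac:(lia)).
    pose proof (Rabs_pos (a (S j))). nra.
Qed.

Lemma PS_mult_recip_coef (a : nat -> R) (n : nat) :
  a 0%nat = 1 ->
  PS_mult a (recip_coef a) n = match n with O => 1 | S _ => 0 end.
Proof.
  intros Ha; unfold PS_mult; destruct n as [|n].
  - simpl; rewrite Ha; unfold recip_coef; simpl; ring.
  - rewrite decomp_sum by lia; simpl pred.
    rewrite Ha, Nat.sub_0_r, recip_coef_S; simpl Nat.sub; ring.
Qed.

Lemma PSeries_recip_coef (a : nat -> R) (x : R) :
  a 0%nat = 1 ->
  Rbar_lt (Rabs x) (CV_radius a) ->
  Rbar_lt (Rabs x) (CV_radius (recip_coef a)) ->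
  PSeries a x * PSeries (recip_coef a) x = 1.
Proof.
  intros Ha Hx Hx'; rewrite <- PSeries_mult by assumption.
  rewrite PSeries_decr_1 by now apply ex_pseries_mult.
  rewrite PS_mult_recip_coef by exact Ha.
  rewrite (PSeries_ext (PS_decr_1 _) (fun _ => 0)), PSeries_const_0; [ring|].
  intros n; unfold PS_decr_1; now rewrite PS_mult_recip_coef.
Qed.

(** * Existence of the Bernoulli numbers *)

(** Telescoping: [1 / (n + 1)! <= 1 / n! - 1 / (n + 1)!] as soon as
    [2 <= n + 1]. *)
Lemma sum_inv_fact_tail_le_1 (n : nat) :
  sum_f_R0 (fun j => Rabs (/ INR (fact (S (S j))))) n <= 1 - / INR (fact (S (S n))).
Proof.
  induction n as [|n IH].
  - simpl; rewrite Rabs_pos_eq; lra.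
  - rewrite tech5.
    set (f := INR (fact (S (S n)))) in *.
    assert (Hf : 0 < f) by apply INR_fact_lt_0.
    assert (Hg : 2 * / INR (fact (S (S (S n)))) <= / f).
    { change (fact (S (S (S n)))) with (S (S (S n)) * fact (S (S n)))%nat.
      rewrite mult_INR; fold f; rewrite Rinv_mult.
      pose proof (Rinv_0_lt_compat f Hf).
      assert (2 * / INR (S (S (S n))) <= 1).
      { rewrite !S_INR; pose proof (pos_INR n).
        apply Rle_div_l; lra. }
      nra. }
    pose proof (Rinv_0_lt_compat _ (INR_fact_lt_0 (S (S (S n))))).
    rewrite Rabs_pos_eq by lra. lra.
Qed.

Lemma is_pseries_expm1_div (t : R) :
  t <> 0 -> is_pseries (fun n => / INR (fact (S n))) t ((exp t - 1) / t).
Proof.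
  intros Ht.
  evar_last.
  - apply (is_pseries_decr_1 (fun n => / INR (fact n)) t (/ t) (exp t)).
    + apply Rinv_l, Ht.
    + apply is_exp_Reals.
  - unfold scal, plus, opp; simpl; unfold mult; simpl. field; exact Ht.
Qed.

(** The sequence chosen by [epsilon] has its defining property once one such
    sequence is exhibited: [k!] times the reciprocal coefficients of
    [(exp t - 1) / t = sum t ^ n / (n + 1)!]. *)
Lemma bernoulli_spec : is_bernoulli bernoulli.
Proof.
  unfold bernoulli; apply epsilon_spec.
  set (a := fun n => / INR (fact (S n))).
  exists (fun k => INR (fact k) * recip_coef a k).
  exists (mkposreal 1 Rlt_0_1); intros t Ht Ht0.
  change (Rabs (t + - 0) < 1) in Ht; rewrite Ropp_0, Rplus_0_r in Ht.
  assert (Ha0 : a 0%nat = 1) by (unfold a; simpl; field).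
  assert (Hb : forall n, Rabs (recip_coef a n) <= 1).
  { intros n; apply recip_coef_bound; intros m.
    eapply Rle_trans; [apply sum_inv_fact_tail_le_1|].
    pose proof (Rinv_0_lt_compat _ (INR_fact_lt_0 (S (S m)))); lra. }
  assert (Ha : forall n, Rabs (a n) <= 1).
  { intros n; unfold a.
    rewrite Rabs_pos_eq by apply Rlt_le, Rinv_0_lt_compat, INR_fact_lt_0.
    rewrite <- Rinv_1; apply Rinv_le_contravar; [lra|].
    change 1 with (INR 1); apply le_INR, lt_O_fact. }
  pose proof (lt_CV_radius_of_coef_le_1 _ _ Ha Ht) as Hra.
  pose proof (lt_CV_radius_of_coef_le_1 _ _ Hb Ht) as Hrb.
  apply is_pseries_ext with (recip_coef a).
  { intros n; change (recip_coef a n = INR (fact n) * recip_coef a n / INR (fact n)).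
    field; apply INR_fact_neq_0. }
  replace (t / (exp t - 1)) with (PSeries (recip_coef a) t);
    [now apply PSeries_correct, CV_radius_inside|].
  pose proof (PSeries_recip_coef a t Ha0 Hra Hrb) as E.
  pose proof (is_pseries_unique _ _ _ (is_pseries_expm1_div t Ht0)) as Ea.
  fold a in Ea; rewrite Ea in E.
  assert (He : exp t - 1 <> 0).
  { intros He; rewrite He in E; unfold Rdiv in E; lra. }
  apply Rmult_eq_reg_l with ((exp t - 1) / t).
  - rewrite E; field; auto.
  - intros H0; rewrite H0 in E; lra.
Qed.

(** * Even parts of series *)

Lemma sum_n_even (w : nat -> R) (N : nat) :
  (forall n, w (2 * n + 1)%nat = 0) ->
  sum_n w (2 * N) = sum_n (fun n => w (2 * n)%nat) N.
Proof.
  intros Hw; induction N as [|N IH].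
  - change (2 * 0)%nat with 0%nat; now rewrite !sum_O.
  - replace (2 * S N)%nat with (S (S (2 * N))) by lia.
    rewrite !sum_Sn, IH.
    replace (S (2 * N)) with (2 * N + 1)%nat by lia.
    replace (S (2 * N + 1)) with (2 * S N)%nat by lia.
    rewrite Hw; unfold plus; simpl; ring.
Qed.

(** The partial sums of the even terms are the partial sums of even order of
    the whole series. *)
Lemma is_series_even (w : nat -> R) (l : R) :
  (forall n, w (2 * n + 1)%nat = 0) ->
  is_series w l -> is_series (fun n => w (2 * n)%nat) l.
Proof.
  intros Hw Hl.
  assert (H : is_lim_seq (fun N => sum_n w (2 * N)) l).
  { apply (is_lim_seq_subseq (sum_n w) l (fun N => 2 * N)%nat).
    - apply eventually_subseq; intros n; lia.
    - exact Hl. }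
  apply (is_lim_seq_ext _ (sum_n (fun n => w (2 * n)%nat))) in H; [exact H|].
  intros N; now apply sum_n_even.
Qed.

(** Averaging the series at [x] and at [- x] cancels the odd terms. *)
Lemma is_pseries_even_part (a : nat -> R) (x l l' : R) :
  is_pseries a x l -> is_pseries a (- x) l' ->
  is_series (fun n => a (2 * n)%nat * x ^ (2 * n)) ((l + l') / 2).
Proof.
  intros Hl Hl'; apply is_pseries_R in Hl; apply is_pseries_R in Hl'.
  pose proof (is_series_scal_l (/ 2) _ _ (is_series_plus _ _ _ _ Hl Hl')) as H.
  assert (Hsum : is_series (fun n => (a n * x ^ n + a n * (- x) ^ n) / 2)
                           ((l + l') / 2)).
  { evar_last.
    - eapply is_series_ext; [|exact H]; intros n.
      unfold scal, plus; simpl; unfold mult; simpl.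
      apply Rmult_comm.
    - unfold scal, plus; simpl; unfold mult; simpl; apply Rmult_comm. }
  apply is_series_even in Hsum.
  - eapply is_series_ext; [|exact Hsum]; intros n.
    replace (- x) with (-1 * x) by ring.
    rewrite Rpow_mult_distr, pow_1_even.
    match goal with |- ?u = ?v => change (@eq R u v) end; field.
  - intros n; replace (2 * n + 1)%nat with (S (2 * n)) by lia.
    replace (- x) with (-1 * x) by ring.
    rewrite Rpow_mult_distr, pow_1_odd; field.
Qed.

(** * The generating function of the Bernoulli numbers *)

(** Clearing the denominator in [t / (exp t - 1)] includes [t = 0] among the
    points at which [b] is required to satisfy the equation, which can then be
    differentiated there. *)
Definition inverts_expm1 (b : nat -> R) (r : R) : Prop :=
  forall t, Rabs t < r ->
    Rbar_lt (Rabs t) (CV_radius b) /\ (exp t - 1) * PSeries b t = t.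

Lemma expm1_div_pos (t : R) : t <> 0 -> 0 < t / (exp t - 1).
Proof.
  intros Ht; destruct (Rdichotomy _ _ Ht) as [Hn|Hp].
  - assert (exp t < 1) by (rewrite <- exp_0; now apply exp_increasing).
    replace (t / (exp t - 1)) with ((- t) / (1 - exp t)) by (field; lra).
    apply Rdiv_lt_0_compat; lra.
  - assert (1 < exp t) by (rewrite <- exp_0; now apply exp_increasing).
    apply Rdiv_lt_0_compat; lra.
Qed.

Lemma expm1_neq_0 (t : R) : t <> 0 -> exp t - 1 <> 0.
Proof.
  intros Ht H0; pose proof (expm1_div_pos t Ht) as Hq.
  rewrite H0 in Hq; unfold Rdiv in Hq; rewrite Rinv_0 in Hq; lra.
Qed.

Lemma bernoulli_inverts_expm1 :
  exists r : R, 0 < r /\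
    inverts_expm1 (fun k => bernoulli k / INR (fact k)) r.
Proof.
  destruct bernoulli_spec as [r Hspec].
  exists r; split; [apply cond_pos|].
  set (b := fun k => bernoulli k / INR (fact k)) in *.
  assert (Hb : forall t, Rabs t < r -> t <> 0 ->
    is_pseries b t (t / (exp t - 1))).
  { intros t Ht Ht0; apply Hspec; [|exact Ht0].
    change (Rabs (t + - 0) < r); now rewrite Ropp_0, Rplus_0_r. }
  intros t Ht; split.
  - apply Rabs_lt_CV_radius with (2 := Ht); intros s Hs.
    eexists; apply Hb; [rewrite Rabs_pos_eq|]; lra.
  - destruct (Req_dec t 0) as [->|Ht0]; [rewrite exp_0; ring|].
    rewrite (is_pseries_unique _ _ _ (Hb t Ht Ht0)).
    field; now apply expm1_neq_0.
Qed.

Lemma locally_Rabs_lt (r t : R) :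
  Rabs t < r -> locally t (fun s => Rabs s < r).
Proof.
  intros Ht; exists (mkposreal _ (proj2 (Rlt_0_minus _ _) Ht)); intros s Hs.
  change (Rabs (s + - t) < r - Rabs t) in Hs.
  replace s with (s + - t + t) by ring.
  eapply Rle_lt_trans; [apply Rabs_triang|lra].
Qed.

Lemma inverts_expm1_eq (b : nat -> R) (r t : R) :
  inverts_expm1 b r -> Rabs t < r -> t <> 0 ->
  PSeries b t = t / (exp t - 1).
Proof.
  intros Hb Ht Ht0; destruct (Hb t Ht) as [_ Hprod].
  pose proof (expm1_neq_0 t Ht0).
  rewrite <- Hprod at 2; field; assumption.
Qed.

Lemma inverts_expm1_is_derive (b : nat -> R) (r t : R) :
  inverts_expm1 b r -> Rabs t < r ->
  is_derive (PSeries b) t (PSeries (PS_derive b) t).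
Proof. intros Hb Ht; apply is_derive_PSeries, Hb, Ht. Qed.

(** The derivative of [(exp t - 1) * P t = t]. *)
Lemma inverts_expm1_ode (b : nat -> R) (r t : R) :
  inverts_expm1 b r -> Rabs t < r ->
  exp t * PSeries b t + (exp t - 1) * PSeries (PS_derive b) t = 1.
Proof.
  intros Hb Ht.
  assert (H1 : is_derive (fun s => (exp s - 1) * PSeries b s) t
    (exp t * PSeries b t + (exp t - 1) * PSeries (PS_derive b) t)).
  { apply (is_derive_mult (fun s => exp s - 1) (PSeries b) t).
    - auto_derive; [trivial|ring].
    - now apply inverts_expm1_is_derive with r.
    - apply Rmult_comm. }
  apply is_derive_unique in H1; rewrite <- H1.
  apply is_derive_unique, is_derive_ext_loc with (fun s : R => s).
  - eapply filter_imp; [|apply locally_Rabs_lt, Ht].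
    intros s Hs; symmetry; now apply Hb.
  - apply @is_derive_id.
Qed.

(** At [t = 0], where [exp t - 1] vanishes, it is the differentiated equation
    that determines the value. *)
Lemma inverts_expm1_at_0 (b : nat -> R) (r : R) :
  0 < r -> inverts_expm1 b r -> PSeries b 0 = 1.
Proof.
  intros Hr Hb.
  pose proof (inverts_expm1_ode b r 0 Hb ltac:(now rewrite Rabs_R0)) as H.
  rewrite exp_0 in H; lra.
Qed.

Lemma inverts_expm1_pos (b : nat -> R) (r t : R) :
  inverts_expm1 b r -> Rabs t < r -> 0 < PSeries b t.
Proof.
  intros Hb Ht; destruct (Req_dec t 0) as [->|Ht0].
  - rewrite (inverts_expm1_at_0 b r); [lra| |exact Hb].
    now rewrite Rabs_R0 in Ht.
  - rewrite (inverts_expm1_eq b r) by assumption; now apply expm1_div_pos.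
Qed.

Lemma inverts_expm1_reflect (b : nat -> R) (r t : R) :
  inverts_expm1 b r -> Rabs t < r -> PSeries b (- t) = exp t * PSeries b t.
Proof.
  intros Hb Ht; destruct (Req_dec t 0) as [->|Ht0].
  - rewrite Ropp_0, exp_0; ring.
  - rewrite !(inverts_expm1_eq b r)
      by (try rewrite Rabs_Ropp; auto; lra).
    rewrite exp_Ropp.
    pose proof (expm1_neq_0 t Ht0); pose proof (exp_pos t).
    field; repeat split; lra.
Qed.

Lemma PSeries_derive_at_0 (b : nat -> R) :
  PSeries (PS_derive b) 0 = PSeries (PS_decr_1 b) 0.
Proof. rewrite !PSeries_0; unfold PS_derive, PS_decr_1; simpl; ring. Qed.

(** The reflection formula [P (- t) = exp t * P t], differentiated at [0],
    reads [- b_1 = 1 + b_1]. *)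
Lemma inverts_expm1_derive_at_0 (b : nat -> R) (r : R) :
  0 < r -> inverts_expm1 b r -> PSeries (PS_derive b) 0 = - / 2.
Proof.
  intros Hr Hb.
  assert (H0r : Rabs 0 < r) by now rewrite Rabs_R0.
  pose proof (inverts_expm1_is_derive b r 0 Hb H0r) as HP'.
  assert (H1 : is_derive (fun t => PSeries b (- t)) 0
                 (- PSeries (PS_derive b) 0)).
  { evar_last; [apply (is_derive_comp (PSeries b) Ropp 0)|].
    - rewrite Ropp_0; exact HP'.
    - apply (is_derive_opp (fun t : R => t)), @is_derive_id.
    - unfold scal, opp, one; simpl; unfold mult; simpl; ring. }
  assert (H2 : is_derive (fun t => PSeries b (- t)) 0
                 (PSeries b 0 + PSeries (PS_derive b) 0)).
  { apply is_derive_ext_loc with (fun t => exp t * PSeries b t).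
    - eapply filter_imp; [|apply locally_Rabs_lt, H0r].
      intros s Hs; symmetry; now apply inverts_expm1_reflect with r.
    - evar_last; [apply (is_derive_mult exp (PSeries b) 0);
        [apply is_derive_exp|exact HP'|apply Rmult_comm]|].
      unfold plus; simpl; unfold mult; simpl; rewrite exp_0; ring. }
  apply is_derive_unique in H1; apply is_derive_unique in H2.
  rewrite H1, (inverts_expm1_at_0 b r Hr Hb) in H2; lra.
Qed.

(** * The logarithm of the generating function *)

(** If [P t = t / (exp t - 1)] is the sum of [b], this is
    [ln (sinh (t / 2) / (t / 2))], extended by [0] to [t = 0]. *)
Definition log_potential (b : nat -> R) (t : R) : R :=
  - ln (PSeries b t) - t / 2.

Lemma log_potential_even (b : nat -> R) (r t : R) :
  inverts_expm1 b r -> Rabs t < r ->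
  log_potential b (- t) = log_potential b t.
Proof.
  intros Hb Ht; unfold log_potential.
  rewrite (inverts_expm1_reflect b r) by assumption.
  rewrite ln_mult, ln_exp; [field|apply exp_pos|].
  now apply inverts_expm1_pos with r.
Qed.

(** The differential equation and [exp t * P = P + t] give
    [t * P' = - P * (P + t - 1)], so that [- P' / P] is [(P - 1) / t + 1],
    where [(P - 1) / t] is the power series with shifted coefficients.  At
    [t = 0], where one cannot divide, the derivative and its claimed value both
    vanish because [b_1 = - 1/2]. *)
Lemma is_derive_log_potential (b : nat -> R) (r t : R) :
  inverts_expm1 b r -> Rabs t < r ->
  is_derive (log_potential b) t (PSeries (PS_decr_1 b) t + / 2).
Proof.
  intros Hb Ht.
  assert (Hr : 0 < r) by (pose proof (Rabs_pos t); lra).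
  pose proof (inverts_expm1_pos b r t Hb Ht) as HPt.
  pose proof (inverts_expm1_ode b r t Hb Ht) as Hode.
  destruct (Hb t Ht) as [Hcv Hprod].
  evar_last.
  - apply (is_derive_minus (fun t => - ln (PSeries b t)) (fun t => t / 2)).
    + apply (is_derive_opp (fun t => ln (PSeries b t))).
      apply (is_derive_comp ln (PSeries b)).
      * now apply is_derive_Reals, derivable_pt_lim_ln.
      * now apply inverts_expm1_is_derive with r.
    + auto_derive; [trivial|reflexivity].
  - unfold minus, plus, opp, scal; simpl; unfold mult; simpl.
    destruct (Req_dec t 0) as [->|Ht0].
    + rewrite <- PSeries_derive_at_0, (inverts_expm1_derive_at_0 b r Hr Hb).
      rewrite (inverts_expm1_at_0 b r Hr Hb); field.
    + assert (Hc : PSeries (PS_decr_1 b) t = (PSeries b t - 1) / t).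
      { rewrite (PSeries_decr_1 b) by now apply CV_radius_inside.
        rewrite <- (PSeries_0 b), (inverts_expm1_at_0 b r Hr Hb).
        field; exact Ht0. }
      rewrite Hc.
      set (P := PSeries b t) in *.
      set (P' := PSeries (PS_derive b) t) in *.
      assert (Hd : P' = - P * (P + t - 1) / t).
      { apply Rmult_eq_reg_l with t; [|exact Ht0].
        transitivity (P * ((exp t - 1) * P'));
          [rewrite <- Hprod at 1; ring|].
        replace ((exp t - 1) * P') with (1 - P - t).
        - field; exact Ht0.
        - rewrite <- Hprod at 1; lra. }
      rewrite Hd; field; split; lra.
Qed.

(** Both sides vanish at [0] and have the same derivative on [(- r, r)]. *)
Lemma log_potential_expansion (b : nat -> R) (r t : R) :
  inverts_expm1 b r -> Rabs t < r ->
  is_pseries (PS_Int (PS_decr_1 b)) t (log_potential b t - t / 2).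
Proof.
  intros Hb Ht.
  assert (Hr : 0 < r) by (pose proof (Rabs_pos t); lra).
  set (q := PS_Int (PS_decr_1 b)).
  assert (Hcv : forall s, Rabs s < r -> Rbar_lt (Rabs s) (CV_radius q)).
  { intros s Hs; unfold q; rewrite CV_radius_Int, CV_radius_decr_1.
    now apply Hb. }
  set (D := fun s => log_potential b s - (PSeries q s + s / 2)).
  assert (HD : forall s, Rabs s < r -> is_derive D s 0).
  { intros s Hs; evar_last.
    - apply (is_derive_minus (log_potential b) (fun s => PSeries q s + s / 2)).
      + now apply is_derive_log_potential with r.
      + apply (is_derive_plus (PSeries q) (fun s => s / 2)).
        * apply is_derive_PSeries; auto.
        * auto_derive; [trivial|reflexivity].
    - rewrite (PSeries_ext (PS_derive q) (PS_decr_1 b)).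
      + unfold minus, plus, opp; simpl; lra.
      + intros n; unfold q, PS_derive, PS_Int; field; apply not_0_INR; lia. }
  assert (Hin : forall s, Rmin 0 t <= s <= Rmax 0 t -> Rabs s < r).
  { intros s; revert Ht; unfold Rmin, Rmax, Rabs.
    destruct (Rle_dec 0 t), (Rcase_abs t), (Rcase_abs s); lra. }
  destruct (MVT_gen D 0 t (fun _ => 0)) as [d [_ Hd]].
  - intros s Hs; apply HD, Hin; lra.
  - intros s Hs; apply derivable_continuous_pt; exists 0.
    apply is_derive_Reals, HD, Hin, Hs.
  - assert (HM0 : log_potential b 0 = 0).
    { unfold log_potential; rewrite (inverts_expm1_at_0 b r Hr Hb), ln_1.
      field. }
    assert (Hq0 : PSeries q 0 = 0) by (rewrite PSeries_0; reflexivity).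
    unfold D in Hd.
    replace (log_potential b t - t / 2) with (PSeries q t) by lra.
    apply PSeries_correct, CV_radius_inside; auto.
Qed.

(** * The exponential mean *)

Lemma exponential_mean_log_potential (b : nat -> R) (r x y : R) :
  inverts_expm1 b r -> Rabs (x - y) < r ->
  exponential_mean x y = (x + y) / 2 + log_potential b (x - y).
Proof.
  intros Hb Ht; set (t := x - y) in *.
  unfold exponential_mean, log_potential.
  destruct (Req_EM_T x y) as [Heq|Hne].
  - assert (Hr : 0 < r) by (pose proof (Rabs_pos t); lra).
    replace t with 0 by (unfold t; lra).
    rewrite (inverts_expm1_at_0 b r Hr Hb), ln_1; rewrite Heq; field.
  - assert (Ht0 : t <> 0) by (unfold t; lra).
    fold t; rewrite (inverts_expm1_eq b r) by assumption.
    rewrite <- ln_Rinv by now apply expm1_div_pos.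
    replace ((exp x - exp y) / t) with (exp y * / (t / (exp t - 1))).
    + rewrite ln_mult, ln_exp; [unfold t; field|apply exp_pos|].
      now apply Rinv_0_lt_compat, expm1_div_pos.
    + replace (exp x) with (exp y * exp t)
        by (rewrite <- exp_plus; f_equal; unfold t; ring).
      field; split; [exact Ht0|now apply expm1_neq_0].
Qed.

Lemma exponential_mean_expansion :
  exists r : R, 0 < r /\ forall x y : R, Rabs (x - y) < r ->
  is_series (fun k =>
      bernoulli (2 * S k) / (INR (2 * S k) * INR (fact (2 * S k)))
      * (x - y) ^ (2 * S k))
    (exponential_mean x y - (x + y) / 2).
Proof.
  destruct bernoulli_inverts_expm1 as [r [Hr Hb]].
  set (b := fun k => bernoulli k / INR (fact k)) in Hb.
  exists r; split; [exact Hr|]; intros x y Ht.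
  rewrite (exponential_mean_log_potential b r) by assumption.
  set (t := x - y) in *.
  assert (Hmt : Rabs (- t) < r) by now rewrite Rabs_Ropp.
  pose proof (is_pseries_even_part _ _ _ _
    (log_potential_expansion b r t Hb Ht)
    (log_potential_expansion b r (- t) Hb Hmt)) as HS.
  rewrite (log_potential_even b r) in HS by assumption.
  eapply is_series_ext; [|apply (is_series_incr_1
    (fun n => PS_Int (PS_decr_1 b) (2 * n) * t ^ (2 * n)))].
  - intros k; cbv beta; f_equal.
    replace (2 * S k)%nat with (S (S (2 * k))) by lia.
    unfold PS_Int, PS_decr_1, b; field; split.
    + apply INR_fact_neq_0.
    + apply not_0_INR; lia.
  - evar_last; [exact HS|].
    set (M := log_potential b t).
    change ((M - t / 2 + (M - - t / 2)) / 2 = (x + y) / 2 + M - (x + y) / 2 + 0 * 1).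
    field.
Qed.

(** * The neighbourhood of the bisector *)

Lemma open_bisector_strip (r : R) :
  open (fun p : R * R => 0 < fst p /\ 0 < snd p /\ Rabs (fst p - snd p) < r).
Proof.
  apply open_and; [|apply open_and].
  - apply (open_comp fst (fun u => 0 < u)); [|apply open_gt].
    intros [x y] _; apply continuous_fst.
  - apply (open_comp snd (fun u => 0 < u)); [|apply open_gt].
    intros [x y] _; apply continuous_snd.
  - apply (open_comp (fun p : R * R => Rabs (fst p - snd p)) (fun u => u < r));
      [|apply open_lt].
    intros [x y] _.
    apply (continuous_comp (fun p : R * R => fst p - snd p) Rabs).
    + apply (continuous_minus (fun p : R * R => fst p) (fun p => snd p)).
      * apply continuous_fst.
      * apply continuous_snd.
    + apply continuous_Rabs.
Qed.

Theorem corollary2p7 :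
  exists U : R * R -> Prop,
    open U /\
    (forall x y : R, U (x, y) -> 0 < x /\ 0 < y) /\
    (forall x : R, 0 < x -> U (x, x)) /\
    forall x y : R, U (x, y) ->
      let A := (x + y) / 2 in
      let g := fun n : nat =>
        Binomial.C (2 * n) n / (16 ^ n * INR (2 * n - 1) * A ^ (2 * n - 1))
          * (x - y) ^ (2 * n) in
      let e := fun n : nat =>
        bernoulli (2 * n) / (INR (2 * n) * INR (fact (2 * n)))
          * (x - y) ^ (2 * n) in
      harmonic_mean x y = A - 1 / (4 * A) * (x - y) ^ 2 /\
      (ex_series (fun k : nat => g (S k)) /\
       geometric_mean x y = A - Series (fun k : nat => g (S k))) /\
      (ex_series (fun k : nat => e (S k)) /\
       exponential_mean x y = A + Series (fun k : nat => e (S k))).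
Proof.
  destruct exponential_mean_expansion as [r [Hr HE]].
  exists (fun p => 0 < fst p /\ 0 < snd p /\ Rabs (fst p - snd p) < r).
  split; [apply open_bisector_strip|].
  split; [simpl; tauto|].
  split.
  { intros x Hx; simpl; rewrite Rminus_diag, Rabs_R0; auto. }
  simpl fst; simpl snd; intros x y [Hx [Hy Hxy]] A g e.
  pose proof (geometric_mean_expansion x y Hx Hy) as HG.
  specialize (HE x y Hxy).
  split; [|split; split].
  - unfold harmonic_mean, A; field; lra.
  - eexists; exact HG.
  - unfold g, A; rewrite (is_series_unique _ _ HG).
    unfold geometric_mean; ring.
  - eexists; exact HE.
  - unfold e, A; rewrite (is_series_unique _ _ HE); ring.
Qed.
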